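(* Let $p \geq 5$ be a prime. Then $K^{\infty}$ (defined in the context) controls $p$-transfer in all finite groups; that is, for every finite group $G$ and every Sylow $p$-subgroup $S$ of $G$, the largest abelian $p$-quotient of $G$ is isomorphic to the largest abelian $p$-quotient of $N_G(K^{\infty}(S))$.
   Context: All groups are finite. A $p$-quotient of a group is a quotient that is a $p$-group. For a group $S$, let $\mathrm{sgp}(S)$ denote the set of all subgroups of $S$. For $\Sigma \subseteq \mathrm{sgp}(S)$, write $B \leq\in \Sigma$ to mean that $B$ is a subgroup of some member of $\Sigma$. Commutators are left-normed: $[A,B,B] = [[A,B],B]$. Definition of $\mathcal{K}(-,-)$: for a $p$-group $S$ and $\Sigma \subseteq \mathrm{sgp}(S)$, $\mathcal{K}(S,\Sigma)$ is the set of all $A \in \mathrm{sgp}(S)$ such that (i) $A$ has nilpotency class at most two (i.e. $[A,A] \leq Z(A)$); (ii) $A$ is normalized by each member of $\Sigma$; (iii) whenever $B \leq\in \Sigma$ satisfies $[A,B,B] \leq Z(A)$, then $[A,B] \leq Z(A)$. Define $\mathcal{K}_0(S) = \mathrm{sgp}(S)$ and $\mathcal{K}_{i+1}(S) = \mathcal{K}(S,\mathcal{K}_i(S))$ for all $i \geq 0$; $\mathcal{K}^{\infty}(S) = \bigcap_{i \text{ even}} \mathcal{K}_i(S)$; and $K^{\infty}(S) = \langle\, \mathcal{K}^{\infty}(S)\,\rangle$, the subgroup of $S$ generated by all members of $\mathcal{K}^{\infty}(S)$. *)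

(* Defs.v *)
From mathcomp Require Import all_boot all_fingroup all_solvable.
From mathcomp Require Import boolp.

Set Implicit Arguments.
Unset Strict Implicit.
Unset Printing Implicit Defensive.

Import GroupScope.

Section KInfinity.

Variable gT : finGroupType.
Implicit Types (S : {set gT}) (Sigma : {set {group gT}}) (A B : {group gT}).

(* B is a subgroup of some member of Sigma. *)
Definition sub_member B Sigma : bool := [exists C in Sigma, B \subset C].

Definition Kset S Sigma : {set {group gT}} :=
  [set A in subgroups S |
    [&& [~: A, A] \subset 'Z(A),
        [forall B in Sigma, B \subset 'N(A)]
      & [forall B : {group gT}, sub_member B Sigma ==>
          ([~: A, B, B] \subset 'Z(A)) ==> ([~: A, B] \subset 'Z(A))]]].

Definition Kseq S (i : nat) : {set {group gT}} := iter i (Kset S) (subgroups S).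

(* The intersection of all Kseq S i with i even. As i ranges over the whole   *)
(* of nat, membership is made boolean by classical reflection.                *)
Definition Kset_infty S : {set {group gT}} :=
  [set A | `[< forall i : nat, ~~ odd i -> A \in Kseq S i >]].

Definition Kinfty S : {set gT} := <<\bigcup_(A in Kset_infty S) A>>.

Canonical Kinfty_group S : {group gT} := Eval hnf in [group of Kinfty S].

End KInfinity.

Section AbelianPQuotient.

Variables (p : nat) (gT : finGroupType).
Implicit Types G N : {group gT}.

(* The least normal subgroup of G whose quotient is an abelian p-group, so    *)
(* that G / abelian_pres p G is the largest abelian p-quotient of G; see      *)
(* abelian_pres_quotient and abelian_pres_min.                                *)
Definition abelian_pres (G : {set gT}) : {set gT} :=
  \bigcap_(N : {group gT} | [&& N <| G, p.-group (G / N) & abelian (G / N)]) N.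

Canonical abelian_pres_group G : {group gT} :=
  Eval hnf in [group of abelian_pres G].

Lemma abelian_pres_min G N :
  N <| G -> p.-group (G / N) -> abelian (G / N) -> abelian_pres G \subset N.
Proof.
by move=> nsNG pGN abGN; apply: (bigcap_inf N); rewrite nsNG pGN abGN.
Qed.

Lemma abelian_pres_normal G : abelian_pres G <| G.
Proof.
rewrite /normal abelian_pres_min ?normal_refl ?trivg_quotient ?pgroup1
  ?abelian1 //=.
by apply: norms_bigcap; apply/bigcapsP=> N /and3P[/normal_norm].
Qed.

Lemma abelian_pres_quotient G :
  p.-group (G / abelian_pres G) /\ abelian (G / abelian_pres G).
Proof.
have /andP[_ nDG] := abelian_pres_normal G.
split; last first.
  apply: sub_der1_abelian; apply/bigcapsP=> N /and3P[/normal_norm nNG _ abGN].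
  by rewrite der1_min.
rewrite -pnat_exponent; apply: (@pnat_dvd _ (#|G|`_p)); last exact: part_pnat.
apply/exponentP=> _ /morphimP[x nDx Gx ->].
rewrite -morphX //; apply: coset_id; apply/bigcapP=> N /and3P[/normal_norm nNG pGN _].
have nNx := subsetP nNG _ Gx.
apply: coset_idr; first exact: groupX.
rewrite morphX //; apply/eqP; rewrite -order_dvdn.
apply: dvdn_trans (order_dvdG (mem_quotient N Gx)) _.
by rewrite -(part_pnat_id pGN) partn_dvd ?dvdn_quotient.
Qed.

End AbelianPQuotient.

(* Main.v *)
Require Import Defs.
From mathcomp Require Import all_boot all_fingroup all_solvable.
From mathcomp Require Import ssralg boolp.

Set Implicit Arguments.
Unset Strict Implicit.
Unset Printing Implicit Defensive.

Import GroupScope GRing.Theory FiniteModule.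

(* Write P for the Sylow subgroup S and N for N_G(Kinfty P). By transfer the
   claim is that P :&: G' \subset N'. Induct on #|G|, and let Q = O_p(G).
     If Q = 1, Alperin's fusion argument reduces P :&: G' to focal subgroups
   of normalisers of nontrivial p-subgroups, which are proper in G.
     If Q != 1, induction in G / Q leaves Q :&: G'. Let U < V <= Q be normal
   in G and let X <= P, X not in Q, satisfy (x - 1)^(p-1) = 0 on V / U for
   all x in X. Transferring to the normaliser M of the weak closure of X in P,
   the contributions to the transfer of V of the cosets other than M are norms
   1 + x + ... + x^(p-1) = (x - 1)^(p-1), hence vanish, so V :&: G' lies in
   M' U, with M proper in G. Now let C be a Thompson critical subgroup of Q.
   If X is cubic on C / Z(C) and quadratic on Z(C), then (x - 1)^4 = 0 on all
   layers of Q, because these embed in groups Hom(E, I / I') with E, I layers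
   of C and I <= Z(C); as 4 <= p - 1, either Q :&: G' \subset N' or each such
   X lies in Q. In the latter case C lies in Kseq P 3, all members of Kseq P 4
   lie in Q, and this forces Kinfty P = Kinfty Q, which is normal in G. *)

(** * Iterated commutators and norms of conjugation actions *)

Lemma iter_commg_mem (gT : finGroupType) (A B U : {group gT}) (n : nat) :
  iter n (fun C : {set gT} => [~: C, B]) A \subset U ->
  {in A & B, forall a b, iter n (commg^~ b) a \in U}.
Proof.
move=> sU a b Aa Bb; apply: (subsetP sU).
by elim: n {sU} => //= n IHn; apply: mem_commg.
Qed.

Lemma three_subgroup_mod (gT : finGroupType) (N A B C : {group gT}) :
    A \subset 'N(N) -> B \subset 'N(N) -> C \subset 'N(N) ->
    [~: A, B, C] \subset N -> [~: B, C, A] \subset N ->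
  [~: C, A, B] \subset N.
Proof.
move=> nA nB nC sABC sBCA.
have comm3N (D E F : {group gT}) : D \subset 'N(N) -> E \subset 'N(N) ->
    F \subset 'N(N) ->
    ([~: D, E, F] \subset N) = ([~: D / N, E / N, F / N] == 1).
  move=> nD nE nF; rewrite -quotientR // -quotientR //; last first.
    by rewrite comm_subG.
  apply/idP/eqP=> [|/trivgP]; first exact: quotientS1.
  by rewrite quotient_sub1 // comm_subG ?comm_subG.
by rewrite comm3N //; apply/eqP/three_subgroup; apply/eqP; rewrite -comm3N.
Qed.

(* In a module the norm 1 + h + ... + h^(n-1) is the sum of the
   'C(n, k+1) (h - 1)^k. *)
Lemma sum_conj_binomial (gT : finGroupType) (Z : zmodType) (V : {group gT})
    (theta : gT -> Z) (h v : gT) (n : nat) :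
    {in V &, {morph theta : x y / x * y >-> (x + y)%R}} ->
    h \in 'N(V) -> v \in V ->
  (\sum_(i < n) theta (v ^ (h ^+ i)) =
     \sum_(k < n) theta (iter k (commg^~ h) v) *+ 'C(n, k.+1))%R.
Proof.
move=> thetaM nVh; elim: n v => [|n IHn] v Vv; first by rewrite !big_ord0.
have Vc : [~ v, h] \in V by rewrite commgEl groupM ?groupV ?memJ_norm.
have VJ w i : w \in V -> w ^ (h ^+ i) \in V.
  by move=> ?; rewrite memJ_norm ?groupX.
have step i : theta (v ^ (h ^+ i.+1)) =
    (theta (v ^ (h ^+ i)) + theta ([~ v, h] ^ (h ^+ i)))%R.
  by rewrite -thetaM ?VJ // expgS conjgM -conjMg commgEl mulKVg.
rewrite big_ord_recl expg0 conjg1 /=.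
under eq_bigr => i _ do rewrite -[bump 0 i]/(i.+1) step.
rewrite big_split /= !IHn //.
under [X in (_ + (_ + X))%R = _]eq_bigr do rewrite -iterSr.
rewrite [RHS]big_ord_recl bin1 [iter _ _ _]/= mulrS -addrA; congr (_ + _)%R.
under [in RHS]eq_bigr => k _ do rewrite binS mulrnDr.
rewrite big_split addrA /=; congr (_ + _)%R.
case: n {IHn} => [|n]; first by rewrite !big_ord0 mulr0n addr0.
rewrite [in RHS]big_ord_recr /= (bin_small (ltnSn _)) mulr0n addr0.
by rewrite big_ord_recl /= bin1.
Qed.

(** In the binomial expansion the coefficients with [k.+1 < p] are multiples of [p], and the last
    term, [k = p.-1], vanishes by assumption. *)
Lemma sum_conj_prime (gT : finGroupType) (Z : zmodType) (V : {group gT})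
    (theta : gT -> Z) (h v : gT) (p : nat) :
    prime p -> {in V &, {morph theta : x y / x * y >-> (x + y)%R}} ->
    {in V, forall x, theta x *+ p = 0}%R ->
    h \in 'N(V) -> v \in V -> theta (iter p.-1 (commg^~ h) v) = 0%R ->
  (\sum_(i < p) theta (v ^ (h ^+ i)) = 0)%R.
Proof.
move=> pr_p thetaM thetap nVh Vv theta0.
rewrite (sum_conj_binomial _ thetaM) //.
have Vc k : iter k (commg^~ h) v \in V.
  by elim: k => //= k Vk; rewrite commgEl groupM ?groupV ?memJ_norm.
apply: big1 => k _; have [ltk | gek] := ltnP k.+1 p.
  have /dvdnP[q ->] : p %| 'C(p, k.+1) by rewrite prime_dvd_bin.
  by rewrite mulrnA mulrnAC thetap // mul0rn.
have -> : k = p.-1 :> nat.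
  by apply/succn_inj/eqP; rewrite prednK ?prime_gt0 // eqn_leq ltn_ord.
by rewrite theta0 mul0rn.
Qed.

(* The stabiliser in X of a point lies in a normal subgroup of index p; a g
   outside it splits the X-orbit into p blocks permuted cyclically by g, so
   that summing over the powers of g first yields norms, which vanish. *)
Lemma sum_rcosets_conj_eq0 (gT : finGroupType) (Z : zmodType) (p : nat)
    (G M V X : {group gT}) (theta : gT -> Z) (O : {set {set gT}}) :
    prime p -> M \subset G -> V <| G ->
    {in V &, {morph theta : x y / x * y >-> (x + y)%R}} ->
    {in V, forall x, theta x *+ p = 0}%R ->
    {in V & M, forall v m, theta (v ^ m) = theta v} ->
    {in V & X, forall v x, {in G, forall y,
       theta (iter p.-1 (commg^~ x) v ^ y) = 0%R}} ->
    p.-group X -> X \subset G -> O \subset rcosets M G ->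
    [acts X, on O | 'Rs] -> {in O, forall s, ~~ (X \subset 'C[s | 'Rs])} ->
  {in V, forall v, \sum_(s in O) theta (v ^ (repr s)^-1) = 0}%R.
Proof.
move=> pr_p sMG nsVG thetaM thetap thetaJ theta0 pX sXG sOG actsO nfixO v Vv.
have nVG := subsetP (normal_norm nsVG).
have reprE x u : u \in V -> x \in G ->
    theta (u ^ (repr (M :* x))^-1) = theta (u ^ x^-1).
  move=> Vu Gx; case: repr_rcosetP => m Mm.
  by rewrite invMg conjgM thetaJ ?groupV // memJ_norm ?nVG ?groupV.
rewrite (set_partition_big _ (orbit_partition actsO)) /=.
apply: big1 => _ /imsetP[s Os ->].
have [x Gx def_s] := rcosetsP (subsetP sOG s Os).
set H := 'C_X[s | 'Rs].
have sHX : H \subset X by apply: subsetIl.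
have [eqHX|[L maxL sHL]] := maximal_exists sHX.
  by case/negP: (nfixO s Os); rewrite -eqHX subsetIr.
have [sLX pLX] := (maxgroupp maxL, p_maximal_index pX maxL).
have nsLX := p_maximal_normal pX maxL.
have [sLX' [g Xg L'g]] := properP sLX.
have Gg := subsetP sXG g Xg.
(* [g] has order [p] modulo [L], so its powers below [p] lie in distinct cosets of [L]. *)
have LgXP i j : i < p -> j < p -> g ^+ i * (g ^+ j)^-1 \in L -> i = j.
  wlog ltji : i j / j < i => [IH lti ltj Lij|].
    have [ltij|ltji|//] := ltngtP i j; last exact: IH.
    by apply/esym/IH => //; rewrite -groupV invMg invgK.
  move=> lti _; rewrite -{1}(subnKC (ltnW ltji)) addnC expgD mulgK => Lg.
  case/negP: L'g.
  have cop : coprime (i - j) p.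
    rewrite coprime_sym prime_coprime // gtnNdvd ?subn_gt0 //.
    exact: leq_ltn_trans (leq_subr _ _) lti.
  have nLg : g \in 'N(L) by apply: subsetP (normal_norm nsLX) g Xg.
  apply: coset_idr => //; apply/eqP; rewrite -order_eq1 -dvdn1 -(eqP cop).
  rewrite dvdn_gcd order_dvdn -morphX //= (coset_id Lg) eqxx /=.
  rewrite -pLX -card_quotient ?normal_norm //.
  by rewrite order_dvdG ?mem_quotient.
pose blk (b : {set gT} * 'I_p) := b.1 :* g ^+ b.2.
set D := setX (orbit 'Rs L s) [set: 'I_p].
have orbE b : b \in orbit 'Rs L s -> exists2 l, l \in L & b = s :* l.
  by case/orbitP=> l Ll <-; exists l => //; rewrite /= rcosetE.
have injblk : {in D &, injective blk}.
  move=> [b i] [c j] /setXP[/= /orbE[l Ll ->] _] /setXP[/= /orbE[k Lk ->] _].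
  rewrite /blk /= -!rcosetM => eqs.
  have eqij : i = j.
    apply/val_inj/LgXP; rewrite ?ltn_ord //.
    rewrite -(groupMl _ Ll) -(groupMr _ (groupVr Lk)) mulgA.
    apply: (subsetP sHL); rewrite /H inE; apply/andP; split.
      by rewrite 3?groupM ?groupV ?groupX // ?groupV (subsetP sLX').
    apply/astab1P; rewrite /= rcosetE -(mulgA (l * _)) -invMg rcosetM eqs.
    by rewrite -rcosetM mulgV rcoset1.
  by move: eqs; rewrite -eqij !rcosetM => /rcoset_inj ->.
(* One inclusion and a count: the [p] translates of the [L]-orbit have together |X : L| |L : C_L(s)|
   = |X : C_L(s)| elements, at least the size of the [X]-orbit. *)
have -> : orbit 'Rs X s = blk @: D.
  apply/eqP; rewrite eq_sym eqEcard; apply/andP; split.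
    apply/subsetP=> _ /imsetP[[b i] /setXP[/= /orbE[l Ll ->] _] ->].
    rewrite /blk /= -rcosetM -rcosetE mem_orbit // groupM ?groupX //.
    exact: (subsetP sLX').
  rewrite (card_in_imset injblk) cardsX cardsT card_ord !card_orbit.
  rewrite -pLX mulnC Lagrange_index ?subsetIl //.
  by rewrite dvdn_leq ?indexg_gt0 ?indexgS ?setSI.
rewrite big_imset //=.
rewrite (eq_bigl (fun b => (b.1 \in orbit 'Rs L s) && true)); last first.
  by move=> [b i]; rewrite !inE.
rewrite -(pair_big _ predT (fun b (i : 'I_p) =>
  theta (v ^ (repr (b :* g ^+ i))^-1))) /=.
apply: big1 => b /orbE[l Ll ->].
have Gl := subsetP sXG l (subsetP sLX' l Ll).
pose y := (x * l)^-1.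
have Gy : y \in G by rewrite groupV groupM.
rewrite (eq_bigr (fun i : 'I_p => theta ((v ^ (g^-1 ^+ i)) ^ y))) => [|i _].
  apply: (@sum_conj_prime _ _ V (fun u => theta (u ^ y)) g^-1 v p) => //.
  - by move=> u w Vu Vw; rewrite conjMg thetaM // memJ_norm // nVG.
  - by move=> u Vu; rewrite thetap // memJ_norm // nVG.
  - by rewrite nVG ?groupV.
  by apply: theta0 => //; rewrite groupV.
rewrite def_s -!rcosetM reprE ?groupM ?groupX //.
by rewrite /y expgVn -conjgM -invMg ?mulgA.
Qed.

(** * Weak closures and their normalisers *)

Section WeakClosure.

Variables (gT : finGroupType) (G X : {group gT}).
Implicit Types D P R : {group gT}.

Definition weak_closure (D : {set gT}) : {set gT} :=
  <<\bigcup_(g in G | X :^ g \subset D) X :^ g>>.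

Canonical weak_closure_group D := Eval hnf in [group of weak_closure D].

Lemma sub_weak_closure (D : {set gT}) g :
  g \in G -> X :^ g \subset D -> X :^ g \subset weak_closure D.
Proof. by move=> Gg sXD; apply: sub_gen; apply: bigcup_sup; apply/andP. Qed.

Lemma weak_closure_min (D : {set gT}) R :
    {in G, forall g, X :^ g \subset D -> X :^ g \subset R} ->
  weak_closure D \subset R.
Proof.
by move=> sXR; rewrite gen_subG; apply/bigcupsP=> g /andP[Gg]; apply: sXR.
Qed.

Lemma weak_closure_sub D : weak_closure D \subset D.
Proof. exact: weak_closure_min. Qed.

Lemma weak_closureS (D E : {set gT}) :
  D \subset E -> weak_closure D \subset weak_closure E.
Proof.
move=> sDE; apply: weak_closure_min => g Gg /subset_trans/(_ sDE).
exact: sub_weak_closure.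
Qed.

Lemma weak_closureJ (D : {set gT}) g :
  g \in G -> weak_closure (D :^ g) = weak_closure D :^ g.
Proof.
have sub (E : {set gT}) h :
    h \in G -> weak_closure E :^ h \subset weak_closure (E :^ h).
  move=> Gh; rewrite sub_conjg; apply: weak_closure_min => k Gk sXE.
  by rewrite -sub_conjg -conjsgM sub_weak_closure ?groupM // conjsgM conjSg.
move=> Gg; apply/eqP; rewrite eqEsubset sub // andbT -sub_conjgV.
by rewrite -{2}(conjsgK g D) sub ?groupV.
Qed.

Lemma weak_closure_norm D : D \subset G -> 'N_G(D) \subset 'N(weak_closure D).
Proof.
move=> sDG; apply/subsetP=> g /setIP[Gg /normP nDg].
by apply/normP; rewrite -weak_closureJ // nDg.
Qed.

Lemma weak_closure_id D : weak_closure (weak_closure D) = weak_closure D.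
Proof.
apply/eqP; rewrite eqEsubset weak_closure_sub.
apply: weak_closure_min => g Gg /sub_weak_closure sX.
by rewrite sub_weak_closure ?sX.
Qed.

(* Otherwise T := N_P(weak_closure R) has weak closure weak_closure R, so that
   N_P(T) = T and hence T = P. *)
Lemma weak_closure_grow P R :
    P \subset G -> nilpotent P -> R \subset P ->
    weak_closure R != weak_closure P ->
  exists2 g, g \in G &
    (X :^ g \subset 'N_P(weak_closure R)) && ~~ (X :^ g \subset weak_closure R).
Proof.
move=> sPG nilP sRP neqRP; apply/exists_inP; apply: contraR neqRP.
rewrite negb_exists_in => /forall_inP nX.
set T := 'N_P(weak_closure R) in nX.
have sRT : weak_closure R \subset T.
  by rewrite subsetI normG (subset_trans (weak_closure_sub R)).
have eqT : weak_closure T = weak_closure R.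
  apply/eqP; rewrite eqEsubset; apply/andP; split.
    by apply: weak_closure_min => g Gg sXT; have:= nX g Gg; rewrite sXT negbK.
  by rewrite -weak_closure_id weak_closureS.
have sTP : T \subset P by apply: subsetIl.
have : 'N_P(T) \subset T.
  rewrite subsetI subsetIl -eqT.
  apply: subset_trans (weak_closure_norm (subset_trans sTP sPG)).
  exact: setSI.
move=> sNT; suff <- : T = P by rewrite eqT.
exact/esym/(nilpotent_sub_norm nilP sTP).
Qed.

(** The conjugate of [weak_closure P] by [x^-1] is a p-subgroup of [M], so some [m] in [M] moves it
    into [P]. Being generated by conjugates of [X], it then lies in [weak_closure P], which
    [x^-1 * m] thus normalises. *)
Lemma weak_closure_Sylow_norm p P x (M := 'N_G(weak_closure P)) :
    p.-Sylow(G) P -> x \in G ->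
  weak_closure (P :&: M :^ x) = weak_closure P -> x \in M.
Proof.
move=> sylP Gx eqY; have [sPG pP _] := and3P sylP.
have nYP : P \subset 'N(weak_closure P).
  by apply: subset_trans (weak_closure_norm sPG); rewrite subsetI sPG normG.
have sylMP : p.-Sylow(M) P.
  by apply: pHall_subl sylP; rewrite ?subsetIl // subsetI sPG.
have sYM : weak_closure P :^ x^-1 \subset M.
  by rewrite sub_conjgV -eqY (subset_trans (weak_closure_sub _)) // subsetIr.
have pY : p.-group (weak_closure P :^ x^-1).
  by rewrite pgroupJ (pgroupS (weak_closure_sub P)).
have [m Mm sYP] := Sylow_Jsub sylMP sYM pY.
have Gm : m \in G by apply: subsetP Mm; apply: subsetIl.
have Gk : x^-1 * m \in G by rewrite groupM ?groupV.
rewrite -groupV -(groupMr _ Mm) inE Gk inE.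
rewrite -{1}[weak_closure P]weak_closure_id -weak_closureJ //.
by rewrite weak_closureS // conjsgM.
Qed.

End WeakClosure.

(** * Transfer to the normaliser of a weak closure *)

Lemma transfer_der1 (gT aT : finGroupType) (G H : {group gT})
    (alpha : {morphism H >-> aT}) (abelA : abelian (alpha @* H)) :
  {in G^`(1), forall x, transfer G abelA x = 0%R}.
Proof.
move=> x G'x; have sG'G := der_sub 1 G.
have : transfer_morphism G abelA x \in (transfer_morphism G abelA @* G)^`(1).
  by rewrite -morphim_der // mem_morphim // (subsetP sG'G).
rewrite (derG1P _) ?inE; last by apply/centsP=> a _ b _; apply: addrC.
by move/eqP.
Qed.

(** As [V] is normal and inside [M], each [v] fixes all cosets of [M], so its transfer is a plain
    product of conjugates. *)
Lemma transfer_normal (gT aT : finGroupType) (G M V : {group gT})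
    (alpha : {morphism M >-> aT}) (abelA : abelian (alpha @* M)) :
    V <| G -> V \subset M ->
  {in V :&: G^`(1), forall v,
    (\sum_(s in rcosets M G) fmod abelA (alpha (v ^ (repr s)^-1)) = 0)%R}.
Proof.
move=> nsVG sVM v /setIP[Vv G'v]; have nVG := subsetP (normal_norm nsVG).
apply: etrans (transfer_der1 abelA G'v); apply: eq_bigr => s Ms.
have [x Gx ->] := rcosetsP Ms; congr (fmod _ (alpha _)).
suff -> : M :* x :* v = M :* x by rewrite conjgE invgK mulgA.
rewrite -rcosetM (conjgCV x v) rcosetM [M :* (_ ^ _)]rcoset_id //.
by rewrite (subsetP sVM) // memJ_norm // nVG ?groupV.
Qed.

Lemma iter_commJ (gT : finGroupType) (v x g : gT) (n : nat) :
  iter n (commg^~ (x ^ g)) (v ^ g) = iter n (commg^~ x) v ^ g.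
Proof. by elim: n => //= n ->; rewrite -conjRg. Qed.

Lemma astab1_rcoset (gT : finGroupType) (M : {group gT}) (x : gT) :
  'C[M :* x | 'Rs] = M :^ x.
Proof. by rewrite -rcosetE astab1_act ?inE // astab1Rs. Qed.

Section FocalNormal.

Variables (gT : finGroupType) (p : nat) (G P : {group gT}).
Hypotheses (pr_p : prime p) (sylP : p.-Sylow(G) P).

Let sPG := pHall_sub sylP.
Let pP := pHall_pgroup sylP.

(* Transfer V :&: G' to M / (M' U Phi(V :&: G')), the cosets other than M
   being grouped according to the weak closure of X in their stabiliser in P. *)
Lemma focal_normal_step (U V X : {group gT}) :
    U <| G -> V <| G -> U \subset V -> V \subset P ->
    X \subset P -> ~~ (X \subset 'O_p(G)) ->
    {in V & X, forall v x, iter p.-1 (commg^~ x) v \in U} ->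
  exists M : {group gT}, [/\ P \subset M, M \proper G
    & V :&: G^`(1) \subset M^`(1) <*> U].
Proof.
move=> nsUG nsVG sUV sVP sXP nsXO nilX.
have sXG := subset_trans sXP sPG.
set Y := weak_closure G X P; pose M := 'N_G(Y)%G; exists M.
have sMG : M \subset G by apply: subsetIl.
have sPM : P \subset M.
  rewrite subsetI sPG; apply: subset_trans (weak_closure_norm X sPG).
  by rewrite subsetI sPG normG.
have sXY : X \subset Y.
  by have:= @sub_weak_closure _ G X P 1 (group1 G); rewrite conjsg1; apply.
(* If [M = G], then [Y] is a normal p-subgroup containing [X], which forces [X] into ['O_p(G)]. *)
have prMG : M \proper G.
  rewrite properEneq sMG andbT; apply: contraNneq nsXO => eqMG.
  apply: subset_trans sXY _; apply: pcore_max.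
    exact: pgroupS (weak_closure_sub _ _ _) pP.
  rewrite /normal (subset_trans (weak_closure_sub _ _ _)) //=.
  by rewrite -{1}eqMG subsetIr.
have sVM := subset_trans sVP sPM.
set W := (V :&: G^`(1))%G.
have nsWG : W <| G by rewrite normalI // der_normal.
have sWV : W \subset V by apply: subsetIl.
have sWM := subset_trans sWV sVM.
have pW : p.-group W by apply: pgroupS (subset_trans sWV sVP) pP.
set K1 := (M^`(1) <*> U)%G; pose K := (K1 <*> 'Phi(W))%G.
have nsUM : U <| M by apply: normalS nsUG; rewrite ?(subset_trans sUV).
have nsFM : 'Phi(W) <| M.
  apply: normalS (gFnormal_trans _ nsWG) => //.
  exact: subset_trans (Phi_sub _) sWM.
have nsKM : K <| M by rewrite !normalY ?der_normal.
have abMK : abelian (M / K).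
  apply: sub_der1_abelian.
  by rewrite (subset_trans _ (joing_subl _ _)) ?joing_subl.
have nKM := normal_norm nsKM.
split=> //; suff sWK : W \subset K.
  have sub : 'Phi(W) <*> (W :&: K1) = W.
    apply/eqP; rewrite eqEsubset join_subG Phi_sub subsetIl /=.
    apply/subsetP=> w Ww; have:= subsetP sWK w Ww.
    rewrite /K /= joingC norm_joinEr; last first.
      apply: subset_trans (normal_norm (gFnormal_trans _ nsWG)).
      by apply: subset_trans sMG; rewrite join_subG der_sub (normal_sub nsUM).
    case/mulsgP=> f k Ff Kk def_w.
    have Wf := subsetP (Phi_sub W) f Ff.
    rewrite def_w groupM ?(subsetP (joing_subl _ _) f Ff) //.
    apply: (subsetP (joing_subr _ _)); rewrite inE Kk andbT.
    by rewrite -(groupMl _ Wf) -def_w.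
  by have:= Phi_nongen sub; rewrite genGid => <-; apply: subsetIr.
apply/subsetP=> v Wv.
have Mv := subsetP sWM v Wv.
have abA : abelian (restrm nKM (coset K) @* M) by rewrite morphim_restrm setIid.
pose theta u := fmod abA (coset K u).
have cM u : u \in M -> coset K u \in restrm nKM (coset K) @* M.
  by move=> Mu; rewrite morphim_restrm setIid mem_quotient.
have thetaK u : u \in K -> theta u = 0%R.
  by move=> Ku; rewrite /theta coset_id // fmod1.
have theta_eq0 u : u \in M -> theta u = 0%R -> u \in K.
  move=> Mu /(congr1 (fun a => fmval a)).
  rewrite fmodK ?cM // => /coset_idr; apply.
  exact: subsetP nKM u Mu.
have thetaM : {in W &, {morph theta : x y / x * y >-> (x + y)%R}}.
  move=> x y Wx Wy; rewrite /theta -fmodM ?cM ?(subsetP sWM) //.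
  by rewrite -morphM // (subsetP nKM) // (subsetP sWM).
apply: theta_eq0 => //; rewrite -[theta v]addr0.
have : (\sum_(s in rcosets M G) theta (v ^ (repr s)^-1) = 0)%R.
  apply: (transfer_normal abA nsWG sWM).
  by rewrite inE Wv (subsetP (subsetIr V _)).
(* The coset [M] contributes [theta v]; the others will be shown to sum to 0. *)
rewrite (bigD1 (gval M)) /=; last by apply/rcosetsP; exists 1; rewrite ?rcoset1.
have thetaJ : {in W & M, forall u m, theta (u ^ m) = theta u}.
  move=> u m Wu Mm; have Mu := subsetP sWM u Wu.
  rewrite /theta morphJ ?(subsetP nKM) // conjgE.
  have cuu : commute (coset K u) (coset K m).
    by apply: (centsP abMK); rewrite mem_quotient.
  by rewrite cuu mulKg.
rewrite thetaJ ?groupV //; last first.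
  exact: mem_repr (group1 M).
move=> sum0; apply: etrans sum0; congr (_ + _)%R; apply/esym.
(* Collect the cosets whose stabilisers in [P] have the same weak closure [Y0] of [X]. Away from the
   coset [M] this is not [Y], so some conjugate of [X] in [P] normalises [Y0] without lying in it:
   it permutes the class and fixes no member. *)
pose kappa (s : {set gT}) := weak_closure G X (P :&: 'C[s | 'Rs]).
rewrite (partition_big kappa predT) //=; apply: big1 => Y0 _.
set O := [set s in rcosets M G | (s != M) && (kappa s == Y0)].
rewrite (eq_bigl (fun s => s \in O)) => [|s]; last by rewrite inE andbA.
have [-> | [s0]] := set_0Vmem O; first by rewrite big_set0.
rewrite inE => /and3P[/rcosetsP[x0 Gx0 ->] neqM /eqP eqY0].
rewrite /kappa astab1_rcoset in eqY0.
pose R := (P :&: M :^ x0)%G.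
have neqY : weak_closure G X R != Y.
  apply: contraNneq neqM => /(weak_closure_Sylow_norm sylP Gx0) Mx0.
  by rewrite rcoset_id.
have [g Gg /andP[sXgN nsXgY]] :=
  weak_closure_grow sPG (pgroup_nil pP) (subsetIl P _) neqY.
rewrite /= eqY0 in sXgN nsXgY.
have nilV u x y : u \in V -> x \in X :^ g -> y \in G ->
    iter p.-1 (commg^~ x) u ^ y \in U.
  move=> Vu /imsetP[z Xz ->] Gy.
  rewrite memJ_norm ?(subsetP (normal_norm nsUG)) //.
  rewrite -(conjgKV g u) iter_commJ memJ_norm ?(subsetP (normal_norm nsUG)) //.
  by rewrite nilX // memJ_norm // (subsetP (normal_norm nsVG)) ?groupV.
have sXgP : X :^ g \subset P by apply: subset_trans sXgN (subsetIl _ _).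
apply: (@sum_rcosets_conj_eq0 _ _ p G M W (X :^ g)%G theta O) => //.
- move=> u Wu; have Mu := subsetP sWM u Wu; rewrite /theta -fmodX ?cM //.
  have <- : coset K (u ^+ p) = coset K u ^+ p by rewrite morphX ?(subsetP nKM).
  rewrite coset_id ?fmod1 //.
  apply: (subsetP (joing_subr _ _)); rewrite (Phi_joing pW).
  apply: (subsetP (joing_subr _ _)).
  exact: (Mho_p_elt 1 Wu (mem_p_elt pW Wu)).
- move=> u x Wu Xx y Gy; apply: thetaK.
  apply: (subsetP (subset_trans (joing_subr _ _) (joing_subl K1 _))).
  by apply: nilV; rewrite ?(subsetP sWV).
- by rewrite pgroupJ (pgroupS sXP).
- by rewrite (subset_trans sXgP).
- by apply/subsetP=> s; rewrite inE => /andP[].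
- apply/subsetP=> u Xu; rewrite !inE; apply/subsetP=> s; rewrite !inE.
  have /setIP[Pu nYu] := subsetP sXgN u Xu; have Gu := subsetP sPG u Pu.
  have Mu := subsetP sPM u Pu.
  move=> /and3P[/rcosetsP[x Gx ->] neqMx /eqP defY0].
  rewrite /= rcosetE; apply/and3P; split.
  + by rewrite -rcosetM; apply/rcosetsP; exists (x * u); rewrite ?groupM.
  + apply: contraNneq neqMx => eqM; rewrite -(rcosetK u (M :* x)) eqM.
    by rewrite rcoset_id ?groupV.
  rewrite /kappa -rcosetE astab1_act ?inE // -{1}(conjGid Pu) -conjIg.
  by rewrite weak_closureJ // -/(kappa _) defY0 (normP nYu).
- move=> s; rewrite inE => /and3P[_ _ /eqP defY0].
  apply: contra nsXgY => sXgC; rewrite -defY0 sub_weak_closure //.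
  by rewrite subsetI sXgP.
Qed.

End FocalNormal.

(** * The focal subgroup theorem *)

(** The transfer of [x] into [P / F] is a product of conjugates in [P] of powers of [x], and these
    have the same image as the powers themselves. So it is the image of [x] to the power |G : P|,
    which is prime to [p]. *)
Lemma focal_subgroup_min (gT : finGroupType) (p : nat) (G P F : {group gT}) :
    p.-Sylow(G) P -> F \subset P ->
    {in P & G, forall x g, x ^ g \in P -> [~ x, g] \in F} ->
  P :&: G^`(1) \subset F.
Proof.
move=> sylP sFP focF; have [sPG pP p'GP] := and3P sylP.
have comPF : [~: P, P] \subset F.
  rewrite gen_subG; apply/subsetP=> _ /imset2P[x y Px Py ->].
  by rewrite focF ?(subsetP sPG) // groupJ.
have nFP : P \subset 'N(F).
  by rewrite -commg_subl (subset_trans _ comPF) // commSg.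
have abA : abelian (restrm nFP (coset F) @* P).
  by rewrite morphim_restrm setIid sub_der1_abelian.
pose theta u := fmod abA (coset F u).
have cP u : u \in P -> coset F u \in restrm nFP (coset F) @* P.
  by move=> Pu; rewrite morphim_restrm setIid mem_quotient.
have thetaX u n : u \in P -> theta (u ^+ n) = (theta u *+ n)%R.
  by move=> Pu; rewrite /theta -fmodX ?cP // morphX ?(subsetP nFP).
have thetaJ u g : u \in P -> g \in G -> u ^ g \in P -> theta (u ^ g) = theta u.
  move=> Pu Gg Pug; rewrite /theta -(mulKVg u (u ^ g)) -commgEl.
  have Fug := focF u g Pu Gg Pug; have Pc := subsetP sFP _ Fug.
  by rewrite morphM ?(subsetP nFP) //= (coset_id Fug) mulg1.
apply/subsetP=> x /setIP[Px G'x]; have Gx := subsetP sPG x Px.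
have [X trX] : {X : {set gT} | is_transversal X (rcosets P G :* <[x]>) G}.
  exists (transversal (rcosets P G :* <[x]>) G).
  exact/transversalP/rcosets_cycle_partition.
have sum0 : (theta x *+ #|G : P| = 0)%R.
  apply: etrans (transfer_der1 abA G'x).
  rewrite (transfer_cycle_expansion sPG abA Gx trX).
  rewrite -(sum_index_rcosets_cycle sPG Gx trX).
  rewrite (big_morph _ (mulrnDr (theta x)) (mulr0n _)); apply: eq_bigr => y Xy.
  have Gy : y \in G := subsetP (transversal_sub trX) y Xy.
  rewrite -thetaX // -(thetaJ _ y^-1) ?groupX ?groupV //.
  rewrite conjgE invgK mulgA -mem_rcoset.
  exact: mulg_exp_card_rcosets.
have thetaP0 : (theta x *+ #|P| = 0)%R.
  rewrite -thetaX // expg_cardG //.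
  exact: etrans (congr1 _ (morph1 _)) (fmod1 _).
have : theta x = 0%R.
  have [[a b] /= def1] := coprimeP _ (cardG_gt0 P) (pnat_coprime pP p'GP).
  have lt_ba : b * #|G : P| < a * #|P| by rewrite -subn_gt0 def1.
  have := mulrnDr (theta x) (b * #|G : P|) (a * #|P| - b * #|G : P|).
  rewrite subnKC ?(ltnW lt_ba) // def1 mulr1n ![(_ * #|_|)%N]mulnC !mulrnA.
  by rewrite thetaP0 sum0 !mul0rn add0r => <-.
move/(congr1 (fun a => fmval a)); rewrite fmodK ?cP // => /coset_idr; apply.
exact: subsetP nFP x Px.
Qed.

(** * The sequence [Kseq] and its limit *)

Section KSequence.

Variable gT : finGroupType.
Implicit Types (S Q A B C Z : {group gT}) (Sigma : {set {group gT}}).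

Lemma KsetP (S : {set gT}) Sigma A :
  reflect [/\ A \subset S, [~: A, A] \subset 'Z(A),
              {in Sigma, forall B, B \subset 'N(A)}
            & {in Sigma, forall C B, B \subset C ->
                 [~: A, B, B] \subset 'Z(A) -> [~: A, B] \subset 'Z(A)}]
          (A \in Kset S Sigma).
Proof.
rewrite !inE; apply: (iffP and4P) => [] [sAS cl2 nA KA]; split=> //.
- exact/forall_inP.
- move=> C SC B sBC sAB; have := forallP KA B.
  by rewrite sAB /= => /implyP->//; apply/exists_inP; exists C.
- exact/forall_inP.
apply/forallP=> B; apply/implyP=> /exists_inP[C SC sBC]; apply/implyP.
exact: KA sBC.
Qed.

Lemma KsetSr (S : {set gT}) Sigma1 Sigma2 :
  Sigma1 \subset Sigma2 -> Kset S Sigma2 \subset Kset S Sigma1.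
Proof.
move=> /subsetP s12; apply/subsetP=> A /KsetP[sAS cl2 nA KA].
by apply/KsetP; split=> // [B|C] /s12; [apply: nA | apply: KA].
Qed.

Lemma KseqS S i A : A \in Kseq S i -> A \subset S.
Proof. by case: i => [|i]; [rewrite inE | case/KsetP]. Qed.

(** [Kset S] reverses inclusions, so both indices can be lowered by one, exchanging their roles,
    until the even one is 0. *)
Lemma Kseq_odd_even S i j : odd i -> ~~ odd j -> Kseq S i \subset Kseq S j.
Proof.
have [n] := ubnP (i + j); elim: n i j => // n IHn [|i] // [|j] ltn oi oj.
  by apply/subsetP=> A /KseqS; rewrite inE.
apply/KsetSr/IHn => //; last by rewrite negbK in oj.
by move: ltn; rewrite addnC addSn addnS ltnS => /ltnW.
Qed.

(** Starting from the largest term [Kseq S 0], antitonicity makes even terms decrease and odd terms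
    increase. *)
Lemma Kseq_even2 S i : ~~ odd i -> Kseq S i.+2 \subset Kseq S i.
Proof.
have mono k : if odd k then Kseq S k \subset Kseq S k.+2
              else Kseq S k.+2 \subset Kseq S k.
  elim: k => [|k] /=; first by apply/subsetP=> A KA; rewrite inE (@KseqS S 2).
  by case: (odd k); apply: KsetSr.
by move=> oi; have:= mono i; rewrite (negPf oi).
Qed.

Lemma Kseq_even_le S i j :
  i <= j -> ~~ odd i -> ~~ odd j -> Kseq S j \subset Kseq S i.
Proof.
move=> leij oi oj; rewrite -(subnKC leij) -[j - i]odd_double_half.
rewrite oddB // (negPf oi) (negPf oj) /=.
elim: _./2 => [|k IHk]; first by rewrite !addn0.
apply: subset_trans IHk; rewrite doubleS !addnS; apply: Kseq_even2.
by rewrite oddD !odd_double (negPf oi).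
Qed.

(** As ['Z(Z) = Z], the conclusion of condition (iii) is that [Z, B] lies in [Z], which is
    normality. *)
Lemma abelian_Kseq S Z i :
  Z \subset S -> S \subset 'N(Z) -> abelian Z -> Z \in Kseq S i.
Proof.
move=> sZS nZS abZ; case: i => [|i]; first by rewrite inE.
have ZZ : 'Z(Z) = Z by apply/center_idP.
apply/KsetP; rewrite ZZ; split=> //; first exact: comm_subG.
  by move=> B /KseqS sBS; apply: subset_trans nZS.
move=> C /KseqS sCS B sBC _.
  by rewrite commg_subl (subset_trans sBC) ?(subset_trans sCS).
Qed.

Lemma Kseq_norm S i A x :
  x \in 'N(S) -> A \in Kseq S i -> (A :^ x)%G \in Kseq S i.
Proof.
elim: i A x => [|i IHi] A x nSx.
  by rewrite !inE /= => sAS; rewrite -(normP nSx) conjSg.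
have ZJ D : 'Z(D :^ x) = 'Z(D) :^ x by rewrite /center centJ conjIg.
have IHV B : B \in Kseq S i -> (B :^ x^-1)%G \in Kseq S i.
  by apply: IHi; rewrite groupV.
case/KsetP=> sAS cl2 nA KA; apply/KsetP; split=> /=.
- by rewrite -(normP nSx) conjSg.
- by rewrite ZJ -conjsRg conjSg.
- by move=> B /IHV/nA; rewrite /= normJ sub_conjgV.
move=> C /IHV SC B sBC; have := KA _ SC (B :^ x^-1)%G.
rewrite /= conjSg ZJ -!(sub_conjgV _ _ x) !conjsRg conjsgK.
by apply.
Qed.

Lemma Kinfty_norm S : 'N(S) \subset 'N(Kinfty S).
Proof.
apply/subsetP=> x nSx; rewrite inE /Kinfty -genJ gen_subG -bigcupJ.
apply/bigcupsP=> A; rewrite inE => /asboolP KA.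
rewrite sub_gen //; apply: (bigcup_sup (A :^ x)%G); rewrite inE.
by apply/asboolP=> i oi; apply: Kseq_norm; last exact: KA.
Qed.

Lemma Kinfty_sub S : Kinfty S \subset S.
Proof.
rewrite gen_subG; apply/bigcupsP=> A; rewrite inE => /asboolP KA.
exact: KseqS (KA 0%N isT).
Qed.

Lemma center_sub_Kinfty S : 'Z(S) \subset Kinfty S.
Proof.
rewrite sub_gen //; apply: (bigcup_sup 'Z(S)%G); rewrite inE.
apply/asboolP=> i _.
apply: abelian_Kseq; rewrite ?center_sub ?center_abelian //.
by rewrite gFnorm.
Qed.

Lemma Kinfty_neq1 (p : nat) S : p.-group S -> S :!=: 1 -> Kinfty S != 1.
Proof.
move=> pS; rewrite -(center_nil_eq1 (pgroup_nil pS)); apply: contraNneq => K1.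
by rewrite -subG1 -K1 center_sub_Kinfty.
Qed.

Lemma Kset_sub S Q Sigma A :
  A \subset Q -> Q \subset S -> (A \in Kset Q Sigma) = (A \in Kset S Sigma).
Proof. by move=> sAQ sQS; rewrite !inE sAQ (subset_trans sAQ sQS). Qed.

(** The two sequences interleave: for even [i], [Kseq Q i] lies between [Kseq S (m + i)] and
    [Kseq S i], so the even intersections agree. *)
Lemma Kinfty_subgroup S Q m :
    Q \subset S -> ~~ odd m -> {in Kseq S m, forall A, A \subset Q} ->
  Kinfty S = Kinfty Q.
Proof.
move=> sQS om sKQ.
have sKQe i A : ~~ odd i -> A \in Kseq S (m + i) -> A \subset Q.
  move=> oi /(subsetP _)KA; apply/sKQ/KA/Kseq_even_le; rewrite ?leq_addr //.
  by rewrite oddD (negPf om).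
have sKQo i A : odd i -> A \in Kseq S i -> A \subset Q.
  by move=> oi KA; apply/sKQ; apply: subsetP KA; apply: Kseq_odd_even.
have le1 i : if odd i then Kseq S i \subset Kseq Q i
             else Kseq Q i \subset Kseq S i.
  elim: i => [|i IHi] /=.
    by apply/subsetP=> A; rewrite !inE => /subset_trans->.
  case oi : (odd i) IHi => /= IHi; have sK T := @KsetSr T _ _ IHi.
    apply/subsetP=> A KA; rewrite /Kseq /= -(@Kset_sub _ Q) ?(@KseqS Q i.+1) //.
    exact: (subsetP (sK Q)).
  apply/subsetP=> A KA.
  have sAQ : A \subset Q by apply: (sKQo i.+1); rewrite //= oi.
  by rewrite /Kseq /= (@Kset_sub S) //; apply: (subsetP (sK S)).
have le2 i : if odd i then Kseq Q i \subset Kseq S (m + i)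
             else Kseq S (m + i) \subset Kseq Q i.
  elim: i => [|i IHi] /=.
    by rewrite addn0; apply/subsetP=> A /sKQ; rewrite inE.
  rewrite addnS; case oi : (odd i) IHi => /= IHi;
    have sK T := @KsetSr T _ _ IHi; last first.
    apply/subsetP=> A KA; rewrite /Kseq /= -(@Kset_sub _ Q) ?(@KseqS Q i.+1) //.
    exact: (subsetP (sK Q)).
  apply/subsetP=> A KA; have sAQ : A \subset Q.
    by apply: (sKQe i.+1); rewrite /= ?oi // addnS.
  by rewrite /Kseq /= (@Kset_sub S) //; apply: (subsetP (sK S)).
suff eqK : Kset_infty S = Kset_infty Q by rewrite /Kinfty eqK.
apply/setP=> A; rewrite !inE; apply/asboolP/asboolP=> KA i oi.
  have := le2 i; rewrite (negPf oi) => /subsetP; apply; apply: KA.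
  by rewrite oddD (negPf om).
by have := le1 i; rewrite (negPf oi) => /subsetP; apply; apply: KA.
Qed.

(** [Z] is in [Kseq S 1] and [A, Z] lies in the abelian group [Z], so condition (iii) for [A],
    tested on [Z], puts [A, Z] in ['Z(A)]. *)
Lemma Kseq2_quadratic S Z A :
    Z \subset S -> S \subset 'N(Z) -> abelian Z -> A \in Kseq S 2 ->
  [~: Z, A, A] = 1.
Proof.
move=> sZS nZS abZ KA; have sAS := KseqS KA.
have K1Z : Z \in Kseq S 1 by apply: abelian_Kseq.
case/KsetP: KA => _ _ _ /(_ Z K1Z Z (subxx _)) KA.
rewrite [[~: Z, A]]commGC; apply/commG1P.
apply: subset_trans (subset_trans (KA _) (subsetIr _ _)) _ => //.
suff -> : [~: A, Z, Z] = 1 by apply: sub1G.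
apply/commG1P; apply: subset_trans abZ.
by rewrite commg_subr (subset_trans sAS).
Qed.

End KSequence.

(** * Commutator action on the layers of a normal p-subgroup *)

Definition commn (gT : finGroupType) (A X : {group gT}) n : {group gT} :=
  iter n (fun B : {group gT} => [~: B, X]%G) A.

Lemma commn_sub (gT : finGroupType) (A X : {group gT}) n :
  X \subset 'N(A) -> commn A X n \subset A /\ X \subset 'N(commn A X n).
Proof.
move=> nAX; elim: n => [|n [IHs IHn]] /=; first by split.
by split; [apply: subset_trans IHs; rewrite commg_subl | rewrite normsR ?normG].
Qed.

(** By the three subgroups lemma, a further commutation of [D] with [X] is traded for one of [E] or
    one of the value in [I]; either raises the index by one. *)
Lemma commn_filter (gT : finGroupType) (X D E : {group gT})
    (I : nat -> {group gT}) (w : nat) :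
    X \subset 'N(D) -> X \subset 'N(E) ->
    (forall k, [/\ X \subset 'N(I k), D \subset 'N(I k) & E \subset 'N(I k)]) ->
    (forall k, [~: I k, X] \subset I k.+1) -> (forall k, I k.+1 \subset I k) ->
    (forall a, [~: commn E X a, D] \subset I (a - w)) ->
  forall b a, [~: commn E X a, commn D X b] \subset I (a + b - w).
Proof.
move=> nDX nEX nI sIX sI sED; elim=> [|b IHb] a; first by rewrite addn0.
have [sDD _] := commn_sub b nDX; have [sEE _] := commn_sub a nEX.
have [nIX nID nIE] := nI (a + b.+1 - w).
rewrite commGC /=; apply: three_subgroup_mod => //.
- exact: subset_trans nIE.
- exact: subset_trans nID.
- by rewrite (commGC X) addnS -addSn; apply: (IHb a.+1).
apply: subset_trans (commSg _ (IHb a)) (subset_trans (sIX _) _).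
(* Subtraction is truncated: for [a + b < w] both indices are 0, and [I 1 \subset I 0] applies. *)
have [lew | ltw] := leqP w (a + b); first by rewrite addnS subSn.
rewrite addnS; move: (ltw); rewrite /leq => /eqP->.
by move: ltw => /ltnW; rewrite /leq => /eqP->.
Qed.

(* D acts on E through Hom(E, I / I'); where X acts cubically on E and
   quadratically on I / I', it acts with nilpotency index 3 + 2 - 1 on D. *)
Lemma commn_cubic_quadratic (gT : finGroupType) (X D E I I' : {group gT}) :
    X \subset 'N(D) -> X \subset 'N(E) -> X \subset 'N(I) -> X \subset 'N(I') ->
    I' <| I -> [~: I, D] \subset I' -> [~: I, E] \subset I' ->
    [~: E, D] \subset I -> [~: E, X, X, X] \subset 'C(D) ->
    [~: I, X, X] \subset I' ->
  [~: E, [~: D, X, X, X, X]] \subset I'.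
Proof.
move=> nDX nEX nIX nI'X /andP[sI'I nI'I] sID sIE sED cEX sIX.
have nsub (A : {group gT}) : [~: I, A] \subset I' ->
    [/\ A \subset 'N(I), A \subset 'N(I') & A \subset 'N([~: I, X] <*> I')].
  move=> sIA; have sII : [~: I, A] \subset I by apply: subset_trans sI'I.
  split; first by rewrite -commg_subr commGC.
    by rewrite -commg_subr commGC (subset_trans _ sIA) ?commSg.
  rewrite -commg_subr commGC (subset_trans _ (joing_subr _ _)) //.
  by rewrite (subset_trans _ sIA) ?commSg // join_subG commg_subl nIX.
have [nID nI'D nI1D] := nsub D sID; have [nIE nI'E nI1E] := nsub E sIE.
pose Is k := match k with 0 => I | 1 => ([~: I, X] <*> I')%G | _ => I' end.
(* The shift is 2: up to [a = 2] the commutator with [D] is only known to lie in [I], and from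
   [a = 3] on it is trivial. For [a = 0] and [b = 4] the index 4 - 2 reaches [I']. *)
apply: (@commn_filter _ X D E Is 2 nDX nEX _ _ _ _ 4 0) =>
  [[|[|k]]|[|[|k]]|[|[|k]]|] //=.
- by split; rewrite // normsY ?normsR ?normG.
- exact: joing_subl.
- have nI'IX : [~: I, X] \subset 'N(I') by rewrite comm_subG.
  rewrite -quotient_cents2 ?join_subG ?nI'IX ?normG //.
  by rewrite quotientYidr // quotient_cents2.
- by rewrite commg_subl.
- by rewrite join_subG commg_subl nIX.
- exact: joing_subr.
case=> [|[|[|a]]] //.
- by apply: subset_trans sED; rewrite /= commSg // commg_subl.
- by apply: subset_trans sED; rewrite commSg // (commn_sub 2 nEX).1.
have -> : commn E X a.+3 = commn (commn E X 3) X a.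
  by rewrite /commn -iterD addn3.
have [sEa _] := commn_sub a (commn_sub 3 nEX).2.
rewrite (_ : [~: _, D] = 1) ?sub1G //; apply/commG1P.
exact: subset_trans cEX.
Qed.

(* Q acts faithfully on C modulo 'Z(C), so every layer of Q embeds in some
   Hom(E, I / I') with E, I layers of C and I inside 'Z(C). *)
Lemma critical_layers (gT : finGroupType) (p : nat) (G Q C X F : {group gT}) :
    p.-group Q -> Q <| G -> C <| G -> C \subset Q -> X \subset G ->
    [~: Q, C] \subset 'Z(C) -> 'C_Q(C) \subset 'Z(C) ->
    [~: C, X, X, X] \subset 'Z(C) -> [~: 'Z(C), X, X] = 1 ->
    F \subset G^`(1) ->
    (forall U V : {group gT}, U <| G -> V <| G -> U \subset V -> V \subset Q ->
       [~: V, X, X, X, X] \subset U -> V :&: G^`(1) \subset F * U) ->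
  Q :&: G^`(1) \subset F.
Proof.
move=> pQ nsQG nsCG sCQ sXG sQCZ cQC sCX cZX sFG' step.
have nilQ := pgroup_nil pQ.
pose gP (A : {group gT}) :=
  [&& A <| G, A \subset Q & Q :&: G^`(1) \subset F * A].
have gPQ : gP Q.
  by rewrite /gP nsQG subxx (subset_trans (subsetIl _ _)) ?mulG_subr.
(* If the minimal [V] is nontrivial, a layer [V / U] killed by four commutations with [X] lets
   [step] replace [V] by [U], a contradiction. *)
have [V /mingroupP[/and3P[nsVG sVQ sQFV] minV] _] := mingroup_exists gPQ.
have [V1 | ntV] := eqVneq (gval V) 1; first by rewrite V1 mulg1 in sQFV.
suff [U [nsUG prUV sVU]] : exists U : {group gT},
    [/\ U <| G, U \proper V & [~: V, X, X, X, X] \subset U].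
  have [sUV _] := andP prUV.
  case/eqP: (proper_neq prUV); apply: minV => //.
  rewrite /gP nsUG (subset_trans sUV) //=.
  apply/subsetP=> x /setIP[Qx G'x].
  have /mulsgP[f v Ff Vv def_x] : x \in F * V.
    by apply: (subsetP sQFV); rewrite inE Qx.
  have G'v : v \in G^`(1) by rewrite -(groupMl _ (subsetP sFG' f Ff)) -def_x.
  rewrite def_x -[gval F]mulGid -mulgA mem_mulg //.
  by apply: (subsetP (step U V _ _ _ _ _)); rewrite ?inE ?Vv.
have nVX : X \subset 'N(V) by apply: subset_trans (normal_norm nsVG).
have nsZG : 'Z(C) <| G by apply: gFnormal_trans.
have ZX (A : {set gT}) : A \subset 'Z(C) -> [~: A, X, X] = 1.
  by move=> sAZ; apply/trivgP; rewrite -cZX !commSg.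
have [cVC | ncVC] := boolP (V \subset 'C(C)).
  have sVZ : V \subset 'Z(C) by apply: subset_trans cQC; rewrite subsetI sVQ.
  by exists 1%G; rewrite normal1 proper1G ntV (ZX _ sVZ) !comm1G sub1G.
pose hP (A : {group gT}) := [&& A <| G, A \subset C & ~~ (V \subset 'C(A))].
have hPC : hP C by rewrite /hP nsCG subxx.
have [E /mingroupP[/and3P[nsEG sEC ncVE] minE] _] := mingroup_exists hPC.
have sEQ := subset_trans sEC sCQ.
pose I := [~: E, V]%G; pose I' := [~: I, Q]%G.
have nsIG : I <| G.
  rewrite /normal normsR ?normal_norm // andbT.
  rewrite (subset_trans _ (normal_sub nsVG)) // commg_subr.
  by rewrite (subset_trans _ (normal_norm nsVG)) ?normal_sub.
have nsI'G : I' <| G.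
  rewrite /normal normsR ?normal_norm // andbT.
  rewrite (subset_trans _ (normal_sub nsIG)) // commg_subl.
  by rewrite (subset_trans _ (normal_norm nsIG)) ?normal_sub.
have sIZ : I \subset 'Z(C).
  by apply: subset_trans sQCZ; rewrite commGC commgSS.
have sIQ : I \subset Q.
  by rewrite (subset_trans sIZ) // (subset_trans (center_sub C)).
have ntI : I :!=: 1 by apply: contra ncVE => /eqP/commG1P; rewrite centsC.
have nGQ (A : {group gT}) : A <| G -> Q \subset 'N(A).
  by move=> nsAG; apply: subset_trans (normal_sub nsQG) (normal_norm nsAG).
have prI'I : I' \proper I.
  by apply: (nil_comm_properl nilQ) => //; rewrite subsetI subxx nGQ.
(* [U] is the kernel of the map from [V] to Hom(E, I / I'). It is proper in [V] because [I], which
   is [E, V], is not inside [I']. *)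
pose U := (V :&: coset I' @*^-1 'C(E / I'))%G; exists U.
have nI'E : E \subset 'N(I') by apply: subset_trans (nGQ _ nsI'G).
have nI'V : V \subset 'N(I') by apply: subset_trans (nGQ _ nsI'G).
have sUP (A : {group gT}) :
    A \subset V -> (A \subset U) = ([~: E, A] \subset I').
  move=> sAV; rewrite subsetI sAV -sub_quotient_pre ?(subset_trans sAV) //.
  by rewrite quotient_cents2 ?(subset_trans sAV) // commGC.
split.
- rewrite /normal subIset ?(normal_sub nsVG) //=.
  apply: normsI; first exact: normal_norm nsVG.
  apply: subset_trans (morphpre_norm _ _).
  rewrite -sub_quotient_pre; last exact: normal_norm nsI'G.
  by rewrite norms_cent // quotient_norms // normal_norm.
- rewrite properE subsetIl /= sUP // -[[~: E, V]]/(gval I).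
  by have [] := andP prI'I.
have [sV4 _] := commn_sub 4 nVX; rewrite sUP //.
have nIX (A : {group gT}) : A <| G -> X \subset 'N(A).
  by move=> nsAG; apply: subset_trans sXG (normal_norm nsAG).
have sI'I : [~: I, Q] \subset I' by [].
apply: (@commn_cubic_quadratic _ X V E I I') => //; try exact: nIX.
- rewrite /normal (proper_sub prI'I).
  by rewrite (subset_trans (normal_sub nsIG)) ?normal_norm.
- exact: subset_trans (commgS _ sVQ) sI'I.
- exact: subset_trans (commgS _ sEQ) sI'I.
(* If [E] is not in ['Z(C)], its minimality makes [V] centralise [E :&: 'Z(C)], which contains
   [E, X, X, X]. *)
- have [sEZ | nsEZ] := boolP (E \subset 'Z(C)).
    by rewrite (ZX _ sEZ) comm1G sub1G.
  rewrite centsC; have sEZE : E :&: 'Z(C) \subset E := subsetIl _ _.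
  have cVEZ : V \subset 'C(E :&: 'Z(C)).
    apply: contraR nsEZ => ncV; rewrite -(minE (E :&: 'Z(C))%G) ?subsetIr //.
    by rewrite /hP normalI //= ncV (subset_trans sEZE).
  rewrite (subset_trans cVEZ) // centS // subsetI (commn_sub 3 (nIX E nsEG)).1.
  by apply: subset_trans sCX; rewrite !commSg.
by rewrite (ZX _ sIZ) sub1G.
Qed.

(* First C \in Kseq P 3, as a B \subset A \in Kseq P 2 that is quadratic on
   C / 'Z(C) lies in Q; then each A \in Kseq P 4 is normalised by C, hence
   cubic on C / 'Z(C). *)
Lemma Kseq4_sub (gT : finGroupType) (P Q C : {group gT}) :
    C \subset P -> P \subset 'N(C) -> [~: C, C] \subset 'Z(C) ->
    [~: Q, C] \subset 'Z(C) ->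
    (forall X : {group gT}, X \subset P -> [~: C, X, X, X] \subset 'Z(C) ->
       [~: 'Z(C), X, X] = 1 -> X \subset Q) ->
  {in Kseq P 4, forall A : {group gT}, A \subset Q}.
Proof.
move=> sCP nCP cl2C sQCZ stabQ A K4A.
have quadZ (B : {group gT}) : B \in Kseq P 2 -> [~: 'Z(C), B, B] = 1.
  apply: Kseq2_quadratic; rewrite ?center_abelian ?gFnorm_trans //.
  by rewrite (subset_trans (center_sub C)).
have K3C : C \in Kseq P 3.
  apply/KsetP; split=> // [B K2B | D K2D B sBD sCBB].
    exact: subset_trans (@KseqS _ P 2 B K2B) nCP.
  have sBP := subset_trans sBD (@KseqS _ P 2 D K2D).
  rewrite (subset_trans _ sQCZ) // commGC commSg // stabQ //.
    rewrite (subset_trans _ sCBB) // commg_subl.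
    by rewrite !normsR ?normG ?(subset_trans sBP).
  by apply/trivgP; rewrite -(quadZ D K2D) !commgSS.
have sAP := @KseqS _ P 4 A K4A.
case/KsetP: (K4A) => _ cl2A nA _; have nCA := nA C K3C.
have sCAA : [~: C, A] \subset A by rewrite commg_subr.
apply: stabQ => //; last first.
  by apply: quadZ; apply: subsetP K4A; apply: (@Kseq_even2 _ P 2).
suff -> : [~: C, A, A, A] = 1 by apply: sub1G.
apply/commG1P; apply: subset_trans (subsetIr A _).
by apply: subset_trans cl2A; rewrite commSg.
Qed.

(** * Reduction modulo the p-core *)

Lemma local_control (gT : finGroupType) (p : nat) (G P : {group gT}) :
    prime p -> 5 <= p -> p.-Sylow(G) P ->
    (forall H : {group gT}, P \subset H -> H \proper G ->
       P :&: H^`(1) \subset ('N_H(Kinfty P))^`(1)) ->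
    (P / 'O_p(G)) :&: (G / 'O_p(G))^`(1) \subset
      ('N_(G / 'O_p(G))(Kinfty (P / 'O_p(G))))^`(1) ->
  P :&: G^`(1) \subset ('N_G(Kinfty P))^`(1).
Proof.
move=> pr_p p_ge5 sylP IHsub IHquo; have [sPG pP _] := and3P sylP.
set N := 'N_G(Kinfty P); set Q := 'O_p(G)%G.
have sNG : N \subset G by apply: subsetIl.
have pQ : p.-group Q := pcore_pgroup p G.
have nsQG : Q <| G := pcore_normal p G.
have sQP : Q \subset P := pcore_sub_Hall sylP.
have sub (H : {group gT}) :
    P \subset H -> H \proper G -> P :&: H^`(1) \subset N^`(1).
  move=> sPH prH; apply: subset_trans (IHsub H _ _) _ => //.
  by rewrite dergS // setSI // proper_sub.
have [eqNG | neqNG] := eqVneq N G; first by rewrite eqNG subsetIr.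
have sQG'N : Q :&: G^`(1) \subset N^`(1).
  have [C [chC sPhiC sQC cQC]] := Thompson_critical pQ.
  have nsCG : C <| G by apply: char_normal_trans chC nsQG.
  have sCQ := char_sub chC; have sCP := subset_trans sCQ sQP.
  apply: contraR neqNG => nsQN.
  suff eqK : Kinfty P = Kinfty Q.
    rewrite /N eqK; apply/eqP/setIidPl.
    by apply: subset_trans (normal_norm nsQG) (Kinfty_norm Q).
  apply: (@Kinfty_subgroup _ P Q 4) => //; apply: (@Kseq4_sub _ P Q C) => //.
  - exact: subset_trans sPG (normal_norm nsCG).
  - rewrite (subset_trans _ sPhiC) // (Phi_joing (pgroupS sCQ pQ)).
    exact: joing_subl.
  move=> X sXP sCX cZX; apply: contraR nsQN => nsXQ.
  apply: (@critical_layers _ p G Q C X [group of N^`(1)]) => //.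
  - exact: subset_trans sXP sPG.
  - by rewrite cQC.
  - exact: dergS.
  move=> U V nsUG nsVG sUV sVQ sVX; have sVP := subset_trans sVQ sQP.
  have [|M [sPM prM sVM]] :=
    focal_normal_step pr_p sylP nsUG nsVG sUV sVP sXP nsXQ.
    move=> v x Vv Xx; have Gx := subsetP sPG x (subsetP sXP x Xx).
    (* Here [5 <= p] enters: four of the [p.-1] commutations lead into [U], and the others stay
       there as [U] is normal. *)
    have -> : p.-1 = (p - 5 + 4)%N by rewrite -{1}(subnK p_ge5) addnS.
    rewrite iterD; elim: (p - 5)%N => [|k IHk].
      exact: (@iter_commg_mem _ V X U 4 sVX v x Vv Xx).
    rewrite iterS commgEl groupM ?groupV ?memJ_norm //.
    by rewrite (subsetP (normal_norm nsUG)).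
  apply/subsetP=> v VG'v; have:= subsetP sVM v VG'v.
  rewrite norm_joinEl => [|]; last first.
    apply: subset_trans (normal_norm nsUG).
    by rewrite (subset_trans (der_sub 1 M)) ?proper_sub.
  case/mulsgP=> m u M'm Uu def_v.
  have Pu := subsetP (subset_trans sUV sVP) u Uu.
  rewrite def_v mem_mulg // (subsetP (sub M sPM prM)) // inE M'm andbT.
  by rewrite -(groupMr _ Pu) -def_v (subsetP sVP) //; case/setIP: VG'v.
have [sPQ | nsPQ] := boolP (P \subset Q).
  by apply: subset_trans sQG'N; apply: setSI.
have nQG := normal_norm nsQG; have nQP := subset_trans sPG nQG.
(* [H] is proper: otherwise [Kinfty (P / Q)] is a nontrivial normal p-subgroup of [G / Q], whose
   p-core is trivial. Each [x] will split as an element of [Q] times one of the derived subgroup of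
   [H]. *)
pose H := (coset Q @*^-1 'N_(G / Q)(Kinfty (P / Q)))%G.
have sHG : H \subset G.
  by rewrite -(quotientGK nsQG) morphpreS // subsetIl.
have sPH : P \subset H.
  rewrite -sub_quotient_pre // subsetI quotientS //.
  exact: subset_trans (normG _) (Kinfty_norm _).
have prHG : H \proper G.
  rewrite properEneq sHG andbT; apply: contraNneq nsPQ => eqHG.
  have nK : G / Q \subset 'N(Kinfty (P / Q)).
    by rewrite -{1}eqHG cosetpreK subsetIr.
  have pPQ : p.-group (P / Q) := quotient_pgroup _ pP.
  rewrite -quotient_sub1 // subG1; apply: contraT => /(Kinfty_neq1 pPQ).
  case/negP; rewrite -subG1 -(trivg_pcore_quotient p G) pcore_max //.
    exact: pgroupS (Kinfty_sub _) pPQ.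
  by rewrite /normal nK (subset_trans (Kinfty_sub _)) ?quotientS.
apply/subsetP=> x /setIP[Px G'x].
have nQx := subsetP nQP x Px.
have : coset Q x \in H^`(1) / Q.
  rewrite quotient_der ?cosetpreK; last exact: subset_trans sHG nQG.
  apply: (subsetP IHquo); rewrite inE mem_quotient //.
  by rewrite -quotient_der // mem_quotient.
case/morphimP=> h nQh H'h /= eqxh.
have /rcosetP[q Qq def_x] : x \in Q :* h.
  by apply/rcoset_kercosetP.
have Ph : h \in P.
  by rewrite -(groupMl _ (subsetP sQP q Qq)) -def_x.
have N'h : h \in N^`(1) by rewrite (subsetP (sub H sPH prHG)) // inE Ph.
have G'h : h \in G^`(1) by apply: subsetP (dergS 1 sHG) h H'h.
rewrite def_x groupM // (subsetP sQG'N) // inE Qq.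
by rewrite -(groupMr _ G'h) -def_x.
Qed.

(** * Fusion through fully normalised subgroups *)

Section Fusion.

Variables (gT : finGroupType) (p : nat) (G P : {group gT}).
Hypothesis sylP : p.-Sylow(G) P.

Let sPG := pHall_sub sylP.
Let pP := pHall_pgroup sylP.

(** The notion from fusion systems, put in Sylow form instead of asking that |N_P(D)| be maximal
    among the conjugates of [D] in [P]. *)
Definition fully_normalized (D : {group gT}) : bool :=
  (D \subset P) && p.-Sylow('N_G(D)) 'N_P(D).

Lemma fully_normalized_conj (D D1 : {group gT}) k :
    fully_normalized D -> D1 \subset P -> k \in G -> D1 :^ k = D ->
  exists2 h, h \in G & D1 :^ h = D /\ 'N_P(D1) :^ h \subset P.
Proof.
case/andP=> sDP sylD sD1P Gk def_D.
have sNk : 'N_P(D1) :^ k \subset 'N_G(D).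
  rewrite -def_D normJ conjIg setSI //.
  by rewrite -(conjGid Gk) conjSg.
have pNk : p.-group ('N_P(D1) :^ k) by rewrite pgroupJ (pgroupS (subsetIl _ _)).
have [n Nn sNkn] := Sylow_Jsub sylD sNk pNk.
have [Gn nDn] := setIP Nn.
exists (k * n); rewrite ?groupM // !conjsgM def_D (normP nDn).
by split=> //; apply: subset_trans sNkn (subsetIl _ _).
Qed.

(** Enlarge ['N_P(D)] to a Sylow p-subgroup of ['N_G(D)] and conjugate the latter into [P]. *)
Lemma fully_normalized_exists (D : {group gT}) :
    D \subset P ->
  exists h, [/\ h \in G, fully_normalized (D :^ h)%G & 'N_P(D) :^ h \subset P].
Proof.
move=> sDP; have pND : p.-group 'N_P(D) := pgroupS (subsetIl _ _) pP.
have [T sylT sNT] := Sylow_superset (setSI 'N(D) sPG) pND.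
have [sTN pT _] := and3P sylT.
have sTG : T \subset G := subset_trans sTN (subsetIl _ _).
have [h Gh sThP] := Sylow_Jsub sylP sTG pT.
have sDT : D \subset T by apply: subset_trans sNT; rewrite subsetI sDP normG.
have sNThP : 'N_P(D) :^ h \subset P by apply: subset_trans sThP; rewrite conjSg.
exists h; split=> //; apply/andP; split.
  by apply: subset_trans sThP; rewrite conjSg.
have sylTh : p.-Sylow('N_G(D :^ h)) (T :^ h).
  by rewrite normJ -{1}(conjGid Gh) -conjIg pHallJ2.
suff -> : 'N_P(D :^ h) = T :^ h by [].
have [sThN _ _] := and3P sylTh.
apply/eqP; rewrite eq_sym eqEcard; apply/andP; split.
  by rewrite subsetI sThP (subset_trans sThN) ?subsetIr.
have pNh : p.-group 'N_P(D :^ h) := pgroupS (subsetIl _ _) pP.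
have [n _ sNT'] := Sylow_Jsub sylTh (setSI _ sPG) pNh.
by rewrite -(cardJg 'N_P(D :^ h) n) subset_leq_card.
Qed.

End Fusion.

(* Alperin's fusion argument: x and x ^ g, with x in D, are compared in
   N_G(D) for D fully normalised, where the hypothesis moves the focal
   subgroup to the normaliser of Kinfty T with T = N_P(D); unless D = P,
   the p-part of both normalisers grows. *)
Lemma fusion_control (gT : finGroupType) (p : nat) (G P : {group gT}) :
    p.-Sylow(G) P ->
    (forall D T : {group gT}, D \subset P -> D :!=: 1 -> p.-Sylow('N_G(D)) T ->
       T :&: ('N_G(D))^`(1) \subset ('N_('N_G(D))(Kinfty T))^`(1)) ->
  P :&: G^`(1) \subset ('N_G(Kinfty P))^`(1).
Proof.
move=> sylP control; have [sPG pP _] := and3P sylP.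
set N := 'N_G(Kinfty P); pose F := (P :&: N^`(1))%G.
have sNG : N \subset G by apply: subsetIl.
have sFP : F \subset P by apply: subsetIl.
have nPN : 'N_G(P) \subset N by rewrite setIS ?Kinfty_norm.
have focP x g : x \in P -> g \in 'N_G(P) -> [~ x, g] \in F.
  move=> Px Ng; have /setIP[Gg nPg] := Ng.
  rewrite inE commgEl groupM ?groupV ?memJ_norm //= -commgEl.
  rewrite mem_commg ?(subsetP nPN) //.
  by rewrite inE (subsetP sPG) // (subsetP (normG P)).
have focNP (D : {group gT}) : D :!=: 1 -> fully_normalized p G P D ->
    'N_P(D) = P -> P :&: ('N_G(D))^`(1) \subset F.
  move=> ntD /andP[sDP sylD] defP; rewrite defP in sylD.
  rewrite subsetI subsetIl (subset_trans (control D P sDP ntD sylD)) //.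
  by rewrite dergS // setSI // subsetIl.
have lt_norm (D : {group gT}) : D \proper P -> #|D| < #|'N_P(D)|.
  by move=> prD; rewrite proper_card // nilpotent_proper_norm ?(pgroup_nil pP).
(* Simultaneous induction on the gap [n] between |P| and the order of [D], respectively of
   ['N_P(D)]. *)
have main n :
    (forall D : {group gT}, D \subset P -> #|P| <= #|D| + n ->
       {in D & G, forall x g, D :^ g \subset P -> [~ x, g] \in F})
    /\ (forall D : {group gT}, D :!=: 1 -> fully_normalized p G P D ->
       #|P| <= #|'N_P(D)| + n -> 'N_P(D) :&: ('N_G(D))^`(1) \subset F).
  elim: n => [|n [IHa IHb]].
    split=> [D sDP leP x g Dx Gg sDg | D ntD fnD leP].
      have defD : D :=: P by apply/eqP; rewrite eqEcard sDP -(addn0 #|D|).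
      by apply: focP; rewrite -?defD // inE Gg inE {2}defD.
    have defN : 'N_P(D) = P.
      by apply/eqP; rewrite eqEcard subsetIl -(addn0 #|'N_P(D)|).
    by rewrite defN focNP.
  have leN (D : {group gT}) :
      D \proper P -> #|P| <= #|D| + n.+1 -> #|P| <= #|'N_P(D)| + n.
    by move=> /lt_norm ltD /leq_trans; apply; rewrite addnS -addSn leq_add2r.
  split=> [D sDP leP x g Dx Gg sDg | D ntD fnD leP].
    have [defD | neqDP] := eqVneq (D : {set gT}) P.
      by apply: focP; rewrite -?defD // inE Gg inE {2}defD.
    have [D1 | ntD] := eqVneq (D : {set gT}) 1.
      by move: Dx; rewrite D1 => /set1P->; rewrite comm1g.
    have prD : D \proper P by rewrite properEneq neqDP.
    have prDg : D :^ g \proper P by rewrite properEcard sDg cardJg proper_card.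
    have [h [Gh fnDh sNh]] := fully_normalized_exists sylP sDP.
    have Gk : g^-1 * h \in G by rewrite groupM ?groupV.
    have [|k Gk' [defDh sNk]] :=
      @fully_normalized_conj _ _ _ _ sylP _ (D :^ g)%G _ fnDh sDg Gk.
      by rewrite -conjsgM mulKVg.
    (* Factor [g] as [h * m * k^-1]: [h] and [k] conjugate the larger groups ['N_P(D)] and
       ['N_P(D :^ g)] into [P], and [m] normalises the fully normalised [D :^ h]. *)
    set m := h^-1 * (g * k).
    have mE : h * m = g * k by rewrite mulKVg.
    have xm : (x ^ h) ^ m = (x ^ g) ^ k by rewrite -!conjgM mE.
    have Nm : m \in 'N_G(D :^ h).
      have Gm : m \in G by rewrite !groupM ?groupV.
      rewrite inE Gm; apply/normP.
      by rewrite -conjsgM mE conjsgM.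
    have Dxh : x ^ h \in D :^ h by rewrite memJ_conjg.
    have sDhP : D :^ h \subset P by case/andP: fnDh.
    have Fxh : [~ x, h] \in F.
      apply: (IHa 'N_P(D)%G); rewrite ?subsetIl ?leN //.
      by rewrite inE (subsetP sDP) // (subsetP (normG D)).
    have Fxgk : [~ x ^ g, k] \in F.
      apply: (IHa 'N_P(D :^ g)%G); rewrite ?subsetIl ?leN ?cardJg //.
      rewrite inE (subsetP sDg) ?memJ_conjg //.
      by rewrite (subsetP (normG (D :^ g))) ?memJ_conjg.
    have Fxm : [~ x ^ h, m] \in F.
      have nDhxh : x ^ h \in 'N(D :^ h) by rewrite (subsetP (normG (D :^ h)%G)).
      have [_ nDhm] := setIP Nm.
      have Dc : [~ x ^ h, m] \in D :^ h.
        by rewrite commgEl groupM ?groupV // memJ_norm.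
      apply: (subsetP (IHb (D :^ h)%G _ fnDh _)).
      - by rewrite -cardG_gt1 cardJg cardG_gt1.
      - by apply: leN; rewrite ?cardJg // properEcard sDhP cardJg proper_card.
      rewrite inE; apply/andP; split.
        by rewrite inE (subsetP sDhP) // (subsetP (normG (D :^ h)%G)).
      by rewrite mem_commg // inE groupJ // (subsetP sPG) // (subsetP sDP).
    have -> : [~ x, g] = [~ x, h] * [~ x ^ h, m] * [~ x ^ g, k]^-1.
      rewrite !commgEl xm; move: (x ^ h) (x ^ g) ((x ^ g) ^ k) => a c b.
      by rewrite invMg invgK !mulgA !mulgK.
    exact: groupM (groupM Fxh Fxm) (groupVr Fxgk).
  have [defN | neqN] := eqVneq 'N_P(D) P; first by rewrite defN focNP.
  have /andP[sDP sylD] := fnD; set T := 'N_P(D)%G in neqN leP sylD *.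
  have sTP : T \subset P by apply: subsetIl.
  have prT : T \proper P by rewrite properEneq neqN.
  have pT : p.-group T := pgroupS sTP pP.
  have sDT : D \subset T by rewrite subsetI sDP normG.
  have ntT : T :!=: 1 by apply: contraNneq ntD => T1; rewrite -subG1 -T1.
  (* ['N_P(E)] contains ['N_P(T)], which is larger than [T], so induction applies to a fully
     normalised conjugate of [E]. *)
  pose E := [group of Kinfty T].
  have ntE : E :!=: 1 := Kinfty_neq1 pT ntT.
  have sEP : E \subset P := subset_trans (Kinfty_sub T) sTP.
  have sNE : 'N_P(T) \subset 'N_P(E) by rewrite setIS ?Kinfty_norm.
  have leE : #|P| <= #|'N_P(E)| + n.
    by apply: leq_trans (leN T prT leP) _; rewrite leq_add2r subset_leq_card.
  have [h [Gh fnEh sNEh]] := fully_normalized_exists sylP sEP.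
  have sNN : 'N_P(E) :^ h \subset 'N_P(E :^ h).
    by rewrite subsetI sNEh normJ conjSg subsetIr.
  apply/subsetP=> u Tu; have /setIP[T1u _] := Tu.
  have NEu : u \in 'N_P(E).
    by rewrite (subsetP sNE) // (subsetP _ u T1u) // subsetI sTP normG.
  have G'u : u \in ('N_G(E))^`(1).
    apply: subsetP (subsetP (control D T sDP ntD sylD) u Tu).
    by rewrite dergS // setSI // subsetIl.
  have Fuh : u ^ h \in F.
    apply: (subsetP (IHb (E :^ h)%G _ fnEh _)).
    - by rewrite -cardG_gt1 cardJg cardG_gt1.
    - apply: leq_trans leE _; rewrite leq_add2r -(cardJg _ h).
      exact: subset_leq_card.
    rewrite inE (subsetP sNN) ?memJ_conjg //=.
    by rewrite normJ -{1}(conjGid Gh) -conjIg derJ memJ_conjg.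
  have Fc : [~ u, h] \in F by apply: (IHa 'N_P(E)%G); rewrite ?subsetIl.
  by move: Fuh; rewrite -(mulKVg u (u ^ h)) -commgEl groupMr.
apply: subset_trans (subsetIr P _).
apply: (focal_subgroup_min sylP sFP) => x g Px Gg Pxg.
apply: ((main #|P|).1 <[x]>%G) => //.
- by rewrite cycle_subG.
- exact: leq_addl.
- exact: cycle_id.
by rewrite -cycleJ cycle_subG.
Qed.

(** * Induction on the group order *)

Lemma focal_control (gT : finGroupType) (p : nat) (G P : {group gT}) :
    prime p -> 5 <= p -> p.-Sylow(G) P ->
  P :&: G^`(1) \subset ('N_G(Kinfty P))^`(1).
Proof.
move=> pr_p p_ge5; have [n] := ubnP #|G|.
(* The type [gT] is generalised as well, since [G / 'O_p(G)] lives in another type. *)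
elim: n => // n IHn in gT G P *; rewrite ltnS => leGn sylP.
have [sPG pP _] := and3P sylP.
have [Q1 | ntQ] := eqVneq 'O_p(G) 1; last first.
  apply: (local_control pr_p p_ge5 sylP) => [H sPH prH|].
    apply: IHn; first exact: leq_trans (proper_card prH) leGn.
    exact: pHall_subl sPH (proper_sub prH) sylP.
  apply: IHn; first exact: leq_trans (ltn_quotient ntQ (pcore_sub p G)) leGn.
  exact: quotient_pHall (subset_trans sPG (gFnorm _ _)) sylP.
apply: (fusion_control sylP) => D T sDP ntD sylT; apply: IHn sylT.
apply: leq_trans leGn; apply: proper_card; rewrite properEneq subsetIl andbT.
apply: contra ntD => /eqP/setIidPl nDG; rewrite -subG1 -Q1 pcore_max //.
  exact: pgroupS sDP pP.
by rewrite /normal (subset_trans sDP).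
Qed.

(** * From focal subgroups to abelian p-quotients *)

(** The preimage of the p'-core of the abelianisation of [G] has an abelian p-group as quotient, and
    it meets [P] only inside the derived subgroup, by coprimality. *)
Lemma Sylow_abelian_pres (gT : finGroupType) (p : nat) (G P : {group gT}) :
  p.-Sylow(G) P -> P :&: abelian_pres p G = P :&: G^`(1).
Proof.
move=> sylP; have [sPG pP _] := and3P sylP.
have nsAG := abelian_pres_normal p G.
have [pGA abGA] := abelian_pres_quotient p G.
apply/eqP; rewrite eqEsubset; apply/andP; split; last first.
  by rewrite setIS // der1_min ?normal_norm.
have nsG'G := der_normal 1 G; set K := 'O_p^'(G / G^`(1)).
have nilGG' := abelian_nil (der_abelian 0 G : abelian (G / G^`(1))).
have hallK : p^'.-Hall(G / G^`(1)) K := nilpotent_pcore_Hall p^' nilGG'.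
pose B := (coset G^`(1) @*^-1 K)%G.
have defG := quotientGK nsG'G.
have nsBG : B <| G by rewrite -[X in _ <| X]defG cosetpre_normal pcore_normal.
have sAB : abelian_pres p G \subset B.
  apply: abelian_pres_min => //; last by rewrite sub_der1_abelian ?sub_cosetpre.
  rewrite /pgroup card_quotient ?normal_norm // -{1}defG index_cosetpre.
  by have [_ _] := and3P hallK; rewrite pnatNK.
have sPAB : P :&: abelian_pres p G \subset P :&: B by apply: setIS.
rewrite subsetI subsetIl (subset_trans sPAB) //.
have nG'P := subset_trans sPG (normal_norm nsG'G).
have nG'PB : P :&: B \subset 'N(G^`(1)) := subset_trans (subsetIl _ _) nG'P.
rewrite -quotient_sub1 //.
have coPK : coprime #|P / G^`(1)| #|K|.
  exact: pnat_coprime (quotient_pgroup _ pP) (pcore_pgroup _ _).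
rewrite -(coprime_TIg coPK) subsetI quotientS ?subsetIl //=.
by rewrite sub_quotient_pre // subsetIr.
Qed.

(** A Sylow p-subgroup covers every p-quotient, so the second isomorphism theorem applies. *)
Lemma isog_abelian_pres (gT : finGroupType) (p : nat) (G P : {group gT}) :
  p.-Sylow(G) P -> G / abelian_pres p G \isog P / (P :&: G^`(1)).
Proof.
move=> sylP; have [sPG pP _] := and3P sylP.
have nsAG := abelian_pres_normal p G.
have [pGA abGA] := abelian_pres_quotient p G.
have nPA := subset_trans sPG (normal_norm nsAG).
have <- : P / abelian_pres p G = G / abelian_pres p G.
  exact: pHall_id (quotient_pHall nPA sylP) pGA.
rewrite -(Sylow_abelian_pres sylP) isog_sym setIC.
exact: second_isog nPA.
Qed.

Theorem theoremB (p : nat) (hp : prime p) (hp5 : (5 <= p)%N)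
    (gT : finGroupType) (G S : {group gT}) (hS : p.-Sylow(G) S) :
  G / abelian_pres p G
    \isog 'N_G(Kinfty S) / abelian_pres p 'N_G(Kinfty S).
Proof.
have sSG := pHall_sub hS.
have sSN : S \subset 'N_G(Kinfty S).
  by rewrite subsetI sSG (subset_trans (normG S)) ?Kinfty_norm.
have sNG : 'N_G(Kinfty S) \subset G := subsetIl _ _.
have hSN : p.-Sylow('N_G(Kinfty S)) S := pHall_subl sSN sNG hS.
have eqF : S :&: G^`(1) = S :&: ('N_G(Kinfty S))^`(1).
  apply/eqP; rewrite eqEsubset subsetI subsetIl (focal_control hp hp5 hS).
  by rewrite setIS ?dergS.
apply: isog_trans (isog_abelian_pres hS) _.
by rewrite eqF isog_sym isog_abelian_pres.
Qed.
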